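(* Let $\alpha>0$ be the constant parameter of the Pruned Plurality Veto rule. Let $m\ge 10$ be an integer and $\beta\ge 1$ be such that $\beta\le\frac{m}{3\ln m}$ and $\beta\ge 2\ln\beta+2\ln\ln m$. Then the utilitarian distortion of the Pruned Plurality Veto rule with $m$ candidates under the Plackett–Luce model with parameter $\beta$ satisfies $$\mathcal{D}_{m,\beta}(\mathrm{PrunedPluralityVeto})\;\ge\;\frac{\beta\ln m}{6}.$$
   Context: Setting. $C$ is a set of $m$ candidates and $\beta\ge 1$ is a real parameter. Let $\mathcal{V}$ be a probability distribution on $[0,1]^C$ (utility vectors). For each $n$, the utility vectors $\mathbf{u}_1,\dots,\mathbf{u}_n$ of $n$ voters are drawn i.i.d. from $\mathcal{V}$, with $u_{i,j}\in[0,1]$ the utility of voter $i$ for candidate $j$. Given the utilities, each voter $i$ independently submits a random ranking $\pi_i$ of $C$ drawn from the Plackett–Luce model: positions are filled from top to bottom, and at each step a candidate $j$ is chosen among the not yet ranked candidates with probability proportional to $e^{\beta u_{i,j}}$. A voting rule $f$ maps each profile $\pi^n=(\pi_1,\dots,\pi_n)$ (for every $n$) to a probability distribution over $C$; it is deterministic if it always selects a single winner. Put $\mathrm{Util}_j=\mathbb{E}_{\mathbf{u}\sim\mathcal{V}}[u_j]$ and $\mathrm{Util}_n(f)=\mathbb{E}\big[\tfrac1n\sum_{i=1}^n u_{i,f(\pi^n)}\big]$, the expectation being over utilities, rankings and any internal randomness of $f$. The utilitarian distortion is $$\mathcal{D}_{m,\beta}(f)=\sup_{\mathcal{V}}\ \limsup_{n\to\infty}\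 \frac{\max_{j\in C}\mathrm{Util}_j}{\mathrm{Util}_n(f)},$$ with the ratio taken to be $1$ if numerator and denominator are both $0$. Plurality Veto rule. First phase: each voter places one token on the candidate they rank first. Second phase: voters, one at a time in an arbitrary but fixed order, each remove one token from the candidate they rank lowest among the candidates that still have tokens. The candidate with a token remaining after $n-1$ removals wins. Pruned Plurality Veto rule with constant $\alpha>0$. Keep only the candidates that are ranked first by at least $\frac{\alpha n}{(6+\alpha)m}$ voters, project all rankings to this restricted candidate set, and run Plurality Veto on the resulting profile. *)

(* Defs.v *)
From HB Require Import structures.
From mathcomp Require Import all_boot all_order all_algebra all_fingroup.
From mathcomp Require Import all_classical all_reals all_analysis.

Set Implicit Arguments.
Unset Strict Implicit.
Unset Printing Implicit Defensive.

Import Order.TTheory GRing.Theory Num.Theory.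
Import numFieldNormedType.Exports.

Local Open Scope ring_scope.

Section Iid.
Context d (T : measurableType d) (R : realType).

Definition tuple_cons n (x : T * n.-tuple T) : n.+1.-tuple T :=
  [tuple of x.1 :: x.2].

Lemma measurable_tuple_cons n : measurable_fun setT (@tuple_cons n).
Proof. exact: measurable_cons. Qed.

HB.instance Definition _ n :=
  isMeasurableFun.Build _ _ _ _ (@tuple_cons n) (@measurable_tuple_cons n).

(* The n-fold product measure, i.e. the law of n independent draws from V. *)
Fixpoint iid (V : probability T R) n : probability (n.-tuple T) R :=
  if n is n'.+1 then distribution (V \x iid V n')%E (@tuple_cons n')
  else dirac [tuple].

End Iid.

Section PluralityVeto.
Variable C : finType.
Implicit Types (n : nat) (c : C).

(* In this section a ranking of a subset of C is the sequence of its elements,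
   best candidate first, so that projecting a ranking amounts to filtering. *)

Definition plurality n (P : 'I_n -> seq C) (c : C) : nat :=
  #|[set i | ohead (P i) == Some c]|.

Definition lowest (s : seq C) (tokens : C -> nat) : option C :=
  ohead (rev [seq c <- s | (0 < tokens c)%N]).

Definition veto n (P : 'I_n -> seq C) (tokens : C -> nat) (i : 'I_n) :
    C -> nat :=
  fun c => (tokens c - (lowest (P i) tokens == Some c))%N.

(* The voters act in the order sigma 0, sigma 1, ..., and only the first n - 1
   of them remove a token.  For n > 0 voters that rank the same nonempty set,
   exactly one token is left, so that the pick is unambiguous. *)
Definition plurality_veto n (sigma : {perm 'I_n}) (P : 'I_n -> seq C) :
    option C :=
  let voters := [seq sigma k | k <- enum 'I_n] in
  let tokens := foldl (veto P) (plurality P) (take n.-1 voters) in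
  [pick c | (0 < tokens c)%N].

Definition unpruned (R : realType) (alpha : R) n (P : 'I_n -> seq C) :
    {set C} :=
  [set c | alpha * n%:R / ((6 + alpha) * #|C|%:R) <= (plurality P c)%:R].

Definition pruned_plurality_veto (R : realType) (alpha : R) n
    (sigma : {perm 'I_n}) (P : 'I_n -> seq C) : option C :=
  plurality_veto sigma (fun i => [seq c <- P i | c \in unpruned alpha P]).

End PluralityVeto.

Section Distortion.
Variables (R : realType) (m : nat).

(* The candidates are 'I_m; a ranking s places candidate s k at position k,
   position 0 being the top. *)
Definition ranking := {perm 'I_m}.
Definition profile n := {ffun 'I_n -> ranking}.

Record lottery := Lottery {
  lottery_prob :> 'I_m -> R;
  lottery_ge0 : forall c, 0 <= lottery_prob c;
  lottery_sum1 : \sum_c lottery_prob c = 1 }.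

Definition voting_rule := forall n, profile n -> lottery.

Fact sure_ge0 (w c : 'I_m) : 0 <= (c == w)%:R :> R.
Proof. exact: ler0n. Qed.

Fact sure_sum1 (w : 'I_m) : \sum_(c < m) (c == w)%:R = 1 :> R.
Proof. by rewrite (bigD1 w)//= eqxx big1 ?addr0// => c /negbTE ->. Qed.

Definition sure (w : 'I_m) : lottery := Lottery (sure_ge0 w) (sure_sum1 w).

Definition deterministic_rule (f : forall n, profile n -> 'I_m) : voting_rule :=
  fun n p => sure (f n p).

(* sigma n is the order in which n voters cast their vetoes.  The candidate c0
   is only selected on the empty profile. *)
Definition PrunedPluralityVeto (alpha : R) (sigma : forall n, {perm 'I_n})
    (c0 : 'I_m) : voting_rule :=
  deterministic_rule (fun n p =>
    odflt c0 (pruned_plurality_veto alpha (sigma n)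
                (fun i => [seq p i k | k <- enum 'I_m]))).

(* Candidates s l with k <= l are those not yet ranked when position k is
   filled. *)
Definition plackett_luce (beta : R) (u : m.-tuple R) (s : ranking) : R :=
  \prod_(k < m) (expR (beta * tnth u (s k)) /
                 \sum_(l < m | (k <= l)%N) expR (beta * tnth u (s l))).

Local Open Scope ereal_scope.

Definition util (V : probability (m.-tuple R) R) (j : 'I_m) : \bar R :=
  'E_V[fun u => tnth u j].

(* The expectation is taken over utilities us by integration, and then, given
   us, over the profile p and the winner c by finite sums. *)
Definition util_rule (beta : R) (V : probability (m.-tuple R) R)
    (f : voting_rule) (n : nat) : \bar R :=
  'E_(iid V n)[fun us =>
    (\sum_(p : profile n)
       (\prod_(i < n) plackett_luce beta (tnth us i) (p i)) *
       \sum_(c < m) f n p c *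
         (n%:R^-1 * \sum_(i < n) tnth (tnth us i) c))%R].

(* Division in \bar R satisfies x / 0 = +oo for x > 0. *)
Definition distortion_ratio (x y : \bar R) : \bar R :=
  if (x == 0) && (y == 0) then 1 else x / y.

Definition on_unit_cube (V : probability (m.-tuple R) R) : Prop :=
  V [set u | forall j, (0 <= tnth u j <= 1)%R]%classic = 1.

(* Utilities being nonnegative, the maximum may start from 0. *)
Definition distortion (beta : R) (f : voting_rule) : \bar R :=
  ereal_sup [set limn_esup (fun n =>
      distortion_ratio (\big[maxe/0]_(j < m) util V j) (util_rule beta V f n))
    | V in [set V | on_unit_cube V]]%classic.

End Distortion.

(* Main.v *)
(* Let b be the default winner c0, M the number of candidates, s = M / 2 and
   E = e^beta.  A fraction p of the voters approves (utility 1) only b, a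
   fraction q approves a uniformly random set of s candidates other than b, and
   the others approve nobody.  A winner of Plurality Veto is ranked first at
   least as often as it is ranked last, since whoever ranks a surviving
   candidate last can only veto it.  The law of a ranking is symmetric in the
   rivals of b, and the differences P(j first) - P(j last) sum to 0 over j, so
   every rival loses with high probability once this difference is positive for
   b.  That holds as soon as p (E / (E + M - 1) - 1 / M) > q / (M - s), while b
   has utility p and the rivals have utility q s / (M - 1) on average; the
   best ratio is about min(E, M) / 8.  The indifferent voters are numerous enough
   for no candidate to be pruned. *)
Require Import Defs.
From HB Require Import structures.
From mathcomp Require Import all_boot all_order all_algebra all_fingroup.
From mathcomp Require Import all_classical all_reals all_analysis measurable_realfun.
From mathcomp Require Import ring lra zify.

Set Implicit Arguments.
Unset Strict Implicit.
Unset Printing Implicit Defensive.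

Import Order.TTheory GRing.Theory Num.Theory.
Import numFieldNormedType.Exports.

Local Open Scope ring_scope.

(** * Token counts in Plurality Veto *)

Section Voting.
Variables (C : finType) (n : nat).
Implicit Types (P : 'I_n -> seq C) (c : C).

Lemma foldl_veto_le P (t : C -> nat) vs c : (foldl (veto P) t vs c <= t c)%N.
Proof.
elim: vs t => //= i vs IH t; apply: leq_trans (IH _) _; exact: leq_subr.
Qed.

Lemma lowest_last P (t : C -> nat) i c :
  ohead (rev (P i)) = Some c -> (0 < t c)%N -> lowest (P i) t = Some c.
Proof.
rewrite /lowest -filter_rev; case: (rev (P i)) => //= x s [->] tc.
by rewrite tc.
Qed.

(** Token counts only decrease, so a candidate with a token at the end had one at every step; each
    voter ranking it last then finds it lowest and removes one of its tokens. *)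
Lemma foldl_veto_last P (t : C -> nat) vs c : (0 < foldl (veto P) t vs c)%N ->
  (foldl (veto P) t vs c + count (fun i => ohead (rev (P i)) == Some c) vs
     <= t c)%N.
Proof.
elim: vs t => [|i vs IH] t /=; first by rewrite addn0.
move=> pos; have tc : (0 < t c)%N.
  apply: leq_trans pos _; apply: leq_trans (foldl_veto_le _ _ _ _) _.
  exact: leq_subr.
have ti : (veto P t i c + (ohead (rev (P i)) == Some c) <= t c)%N.
  rewrite /veto; case: (ohead (rev (P i)) =P Some c) => [/lowest_last -/(_ _ tc)->|_].
    by rewrite eqxx subn1 addn1 prednK.
  by rewrite addn0 leq_subr.
apply: leq_trans ti; rewrite addnCA addnC leq_add2r; exact: IH.
Qed.

(* A voter who ranks a surviving candidate last can only veto that candidate. *)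
Lemma plurality_veto_winner (sigma : {perm 'I_n}) P c :
  plurality_veto sigma P = Some c ->
  (#|[set i | ohead (rev (P i)) == Some c]| <= plurality P c)%N.
Proof.
rewrite /plurality_veto; set vs := map _ _; case: pickP => // c' /[swap] -[->].
move=> pos; have := foldl_veto_last pos; set a := fun i => _.
set f := foldl _ _ _ _ in pos *.
have -> : #|[set i | ohead (rev (P i)) == Some c]| = count a vs.
  rewrite cardsE cardE size_filter -/a; apply/seq.permP.
  rewrite -enumT; apply: uniq_perm; [exact: enum_uniq | |].
    by rewrite (map_inj_uniq (@perm_inj _ sigma)) enum_uniq.
  by move=> i; rewrite mem_enum inE -(permKV sigma i) (mem_map (@perm_inj _ sigma)) mem_enum.
(* The one voter who does not veto adds at most 1 to the number of last places, and the token left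
   to [c] pays for it. *)
rewrite -{2}(cat_take_drop n.-1 vs) count_cat.
apply: leq_trans; rewrite addnC leq_add2r; apply: leq_trans pos.
apply: leq_trans (count_size _ _) _.
by rewrite size_drop size_map size_enum_ord; case: (n) => //= k; rewrite subSnn.
Qed.

End Voting.

(** When every candidate passes the threshold, the projection is the identity and the bound for
    Plurality Veto applies to the rankings themselves. *)
Lemma pruned_plurality_veto_winner (R : realType) (alpha : R) (m n : nat)
    (sigma : {perm 'I_n}) (p : profile m.+1 n) (c : 'I_m.+1) :
  (forall j, alpha * n%:R / ((6 + alpha) * m.+1%:R) <=
             #|[set i | p i ord0 == j]|%:R) ->
  pruned_plurality_veto alpha sigma
    (fun i => [seq p i k | k <- enum 'I_m.+1]) = Some c ->
  (#|[set i | p i ord_max == c]| <= #|[set i | p i ord0 == c]|)%N.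
Proof.
set P := (X in pruned_plurality_veto _ _ X) => unpr.
have plurE j : plurality P j = #|[set i | p i ord0 == j]|.
  by apply: eq_card => i; rewrite !inE /P enum_ordSl.
have allin : unpruned alpha P = [set: 'I_m.+1]%SET.
  by apply/setP => j; rewrite !inE plurE card_ord unpr.
rewrite /pruned_plurality_veto allin.
have -> : (fun i => [seq x <- P i | x \in [set: 'I_m.+1]%SET]) = P.
  by apply/funext => i; apply/all_filterP/allP => x; rewrite inE.
move=> /plurality_veto_winner; rewrite plurE; apply: leq_trans.
apply/eq_leq/eq_card => i; rewrite !inE /P.
by rewrite enum_ordSr map_rcons rev_rcons.
Qed.

(** * Marginals of the Plackett-Luce law *)

Section PlackettLuce.
Variables (R : realFieldType) (m : nat).
Implicit Types (w : 'I_m.+1 -> R) (s : {perm 'I_m.+1}) (c : 'I_m.+1).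

(** Arbitrary weights [w] replace the exponentials e^(beta u) of [plackett_luce]. *)
Definition pl w s : R :=
  \prod_(k < m.+1) (w (s k) / \sum_(l < m.+1 | (k <= l)%N) w (s l)).

Lemma tail_sum_gt0 w s (k : 'I_m.+1) : (forall c, 0 < w c) ->
  0 < \sum_(l < m.+1 | (k <= l)%N) w (s l).
Proof.
move=> w0; rewrite (bigD1 k)//= ltr_wpDr//; apply: sumr_ge0 => l _; exact: ltW.
Qed.

Lemma pl_gt0 w s : (forall c, 0 < w c) -> 0 < pl w s.
Proof. by move=> w0; apply: prodr_gt0 => k _; rewrite divr_gt0// tail_sum_gt0. Qed.

Lemma pl_perm w s (t : {perm 'I_m.+1}) : pl w (s * t)%g = pl (w \o t) s.
Proof.
by apply: eq_bigr => k _; rewrite permM; congr (_ / _); apply: eq_bigr => l _; rewrite permM.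
Qed.

Definition agree s (t : nat) s' := [forall k : 'I_m.+1, (k < t)%N ==> (s' k == s k)].

Lemma agreeP s t s' : reflect (forall k : 'I_m.+1, (k < t)%N -> s' k = s k) (agree s t s').
Proof.
apply: (iffP forallP) => [h k kt|h k]; first by move: (h k); rewrite kt => /eqP.
by apply/implyP => /h ->.
Qed.

(** Induction on the number [d] of free positions: fixing one more position in all possible ways
    produces factors that sum to 1. *)
Lemma sum_pl_prefix w s (t : nat) : (forall c, 0 < w c) -> (t <= m.+1)%N ->
  \sum_(s' | agree s t s') pl w s' =
  \prod_(k < m.+1 | (k < t)%N) (w (s k) / \sum_(l < m.+1 | (k <= l)%N) w (s l)).
Proof.
move=> w0; move: {2}(m.+1 - t)%N (erefl (m.+1 - t)%N) => d.
elim: d t s => [|d IH] t s tE tm.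
  have {tE tm} -> : t = m.+1 by apply/eqP; rewrite eqn_leq tm -subn_eq0 tE eqxx.
  rewrite (big_pred1 s) => [|s'].
    by apply: eq_bigl => k; rewrite ltn_ord.
  apply/agreeP/eqP => [h|->//]; apply/permP => k; exact: h.
have {tm} tm : (t < m.+1)%N by rewrite -subn_gt0 tE.
pose k0 := Ordinal tm.
(* Split by the candidate [s l] that [s'] puts at position [t]; the candidates [s l] with [l < t]
   are already placed. *)
rewrite (partition_big (fun s' => (s^-1)%g (s' k0)) (fun l : 'I_m.+1 => (t <= l)%N))/=; last first.
  move=> s' /agreeP h; rewrite leqNgt; apply/negP => lt.
  have := h _ lt; rewrite permKV => /perm_inj e.
  by move: lt; rewrite e ltnn.
have step (l : 'I_m.+1) : (t <= l)%N ->
  \sum_(s' | agree s t s' && ((s^-1)%g (s' k0) == l)) pl w s' =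
  \prod_(k < m.+1 | (k < t)%N) (w (s k) / \sum_(l < m.+1 | (k <= l)%N) w (s l)) *
   (w (s l) / \sum_(l < m.+1 | (k0 <= l)%N) w (s l)).
  (* [sl] brings [s l] to position [t] and moves only positions from [t] on, so the prefix and all
     tail sums starting at or before [t] are those of [s]. *)
  move=> tl; pose sl := (tperm k0 l * s)%g.
  have slE (k : 'I_m.+1) : (k < t)%N -> sl k = s k.
    move=> kt; rewrite permM tpermD//; apply/negP => /eqP e.
      by rewrite -e ltnn in kt.
    by move: (leq_trans kt tl); rewrite e ltnn.
  have slk0 : sl k0 = s l by rewrite permM tpermL.
  have tailE (k : 'I_m.+1) : (k <= t)%N ->
      \sum_(l < m.+1 | (k <= l)%N) w (sl l) = \sum_(l < m.+1 | (k <= l)%N) w (s l).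
    move=> kt; rewrite [RHS](reindex_inj (@perm_inj _ (tperm k0 l))).
    apply: eq_big => [i|i _]; last by rewrite permM.
    case: tpermP => [->|->|//] /=; first by rewrite kt (leq_trans kt).
    by rewrite kt (leq_trans kt).
  rewrite (eq_bigl (agree sl t.+1)); last first.
    move=> s'; apply/andP/agreeP => [[/agreeP h /eqP e] k|h].
      rewrite ltnS leq_eqVlt => /predU1P[kt|kt]; last by rewrite h// slE.
      by have -> : k = k0; [exact: val_inj | rewrite slk0 -e permKV].
    split; last by rewrite h ?slk0 ?permK//=.
    by apply/agreeP => k kt; rewrite h ?slE// ltnS ltnW.
  rewrite IH ?subnS ?tE// (bigD1 k0)/= ?ltnS// slk0 [X in _ / X](tailE k0)//.
  rewrite [LHS]mulrC; congr (_ * _).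
  have ltE (k : 'I_m.+1) : (k < t.+1)%N && (k != k0) = (k < t)%N.
    by rewrite ltnS andbC -val_eqE -ltn_neqAle.
  by apply: eq_big => // k; rewrite ltE => kt; rewrite slE// tailE// ltnW.
rewrite (eq_bigr _ step) -big_distrr/= -mulr_suml divff ?mulr1//.
by rewrite gt_eqF// (tail_sum_gt0 s k0).
Qed.

Lemma sum_pl w : (forall c, 0 < w c) -> \sum_s pl w s = 1.
Proof.
move=> w0; have := sum_pl_prefix 1%g w0 (leq0n m.+1).
rewrite [RHS]big1// => <-; apply: eq_bigl => s; symmetry; exact/agreeP.
Qed.

Lemma sum_pl_first w c : (forall c, 0 < w c) ->
  \sum_(s : {perm 'I_m.+1} | s ord0 == c) pl w s = w c / \sum_c' w c'.
Proof.
move=> w0; have := sum_pl_prefix (tperm ord0 c) w0 (ltn0Sn m).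
rewrite (eq_bigl (fun s : {perm 'I_m.+1} => s ord0 == c)); last first.
  move=> s; apply/agreeP/eqP => [->//|e k]; first by rewrite tpermL.
  by rewrite ltnS leqn0 => /eqP k0; rewrite (_ : k = ord0) ?tpermL//; exact: val_inj.
rewrite (big_pred1 ord0) => [->|k]; last by rewrite ltnS leqn0.
rewrite tpermL; congr (_ / _).
by rewrite [RHS](reindex_inj (@perm_inj _ (tperm ord0 c))); apply: eq_bigl.
Qed.

(* Exchanging b in last place with a lighter j leaves the numerators alone and
   can only shrink the denominators. *)
Lemma pl_tperm_last w s b j : (forall c, 0 < w c) -> w j <= w b ->
  s ord_max = b -> pl w s <= pl w (s * tperm b j)%g.
Proof.
move=> w0 wjb sb; rewrite /pl !prodf_div/=.
have prodE s' : \prod_(i < m.+1) w (s' i) = \prod_i w i.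
  by rewrite [RHS](reindex_inj (@perm_inj _ s')).
rewrite !prodE ler_wpM2l//; first by apply: prodr_ge0 => i _; exact: ltW.
rewrite lef_pV2 ?qualifE/= ?prodr_gt0// => [|k _|k _]; try exact: tail_sum_gt0.
apply: ler_prod => k _; rewrite ltW ?tail_sum_gt0//=.
have [->|nbj] := eqVneq b j; first by rewrite tperm1 mulg1.
pose k0 := (s^-1)%g j; have sk0 : s k0 = j by rewrite permKV.
have k0max : k0 != ord_max by apply: contra_neq nbj => e; rewrite -sb -sk0 e.
rewrite !(bigD1 ord_max (P := fun l : 'I_m.+1 => (k <= l)%N)) ?leq_ord//=.
rewrite !permM sb tpermL.
have rest (Q : pred 'I_m.+1) :
  \sum_(l < m.+1 | Q l && (l != ord_max) && (l != k0)) w ((s * tperm b j)%g l) =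
  \sum_(l < m.+1 | Q l && (l != ord_max) && (l != k0)) w (s l).
  apply: eq_bigr => l /andP[/andP[_ lm] lk]; rewrite permM tpermD//.
    by apply: contra_neq lm; rewrite -sb => /perm_inj.
  by apply: contra_neq lk; rewrite -sk0 => /perm_inj.
(* If the tail from [k] contains both exchanged positions, its sum is unchanged; otherwise it
   contains only the last one, where [b] gives way to the lighter [j]. *)
have [kk0|kk0] := leqP k k0.
  rewrite !(bigD1 k0 (P := fun l : 'I_m.+1 => (k <= l)%N && (l != ord_max))) ?kk0 ?k0max//=.
  by rewrite permM sk0 tpermR (rest (fun l : 'I_m.+1 => (k <= l)%N)) addrCA.
apply: lerD => //; rewrite le_eqVlt; apply/orP; left; apply/eqP.
have := rest (fun l : 'I_m.+1 => (k <= l)%N).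
by congr (_ = _); apply: eq_bigl => l; rewrite andb_idr// => /andP[kl _];
  apply: contraTneq kl => ->; rewrite -ltnNge.
Qed.

Lemma sum_pl_last_le w b j : (forall c, 0 < w c) -> w j <= w b ->
  \sum_(s : {perm 'I_m.+1} | s ord_max == b) pl w s <=
  \sum_(s : {perm 'I_m.+1} | s ord_max == j) pl w s.
Proof.
move=> w0 wjb; rewrite [leRHS](reindex_inj (mulIg (tperm b j)))/=.
rewrite [leRHS](eq_bigl (fun s : {perm 'I_m.+1} => s ord_max == b)).
  by apply: ler_sum => s /eqP sb; exact: pl_tperm_last.
by move=> s; rewrite permM (canF_eq (tpermK b j)) tpermR.
Qed.

(** Each candidate no heavier than [b] comes last at least as often as [b], and these events are
    disjoint. *)
Lemma sum_pl_last w b : (forall c, 0 < w c) ->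
  #|[set j | w j <= w b]|%:R * (\sum_(s : {perm 'I_m.+1} | s ord_max == b) pl w s) <= 1.
Proof.
move=> w0; rewrite -[leRHS](sum_pl w0) mulr_natl -sumr_const.
rewrite [leRHS](partition_big (fun s : {perm 'I_m.+1} => s ord_max) xpredT)//=.
rewrite [leRHS](bigID (mem [set j | w j <= w b]))/= ler_wpDr//.
  by apply: sumr_ge0 => j _; apply: sumr_ge0 => s _; rewrite ltW// pl_gt0.
by apply: ler_sum => j; rewrite inE => wj; exact: sum_pl_last_le.
Qed.

End PlackettLuce.

(** * Finitely supported measures and their powers *)

Section FiniteMixture.
Context d (T : measurableType d) (R : realType) (K : finType).

Record weights := Weights {
  weight :> K -> {nonneg R};
  weight_sum : \sum_k (weight k)%:num = 1 }.

Variables (w : weights) (x : K -> T).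

Local Open Scope ereal_scope.

(** [msum] expects a family indexed by [nat]; indices from [#|K|] on receive the zero measure. *)
Definition mixture_part (i : nat) : {measure set T -> \bar R} :=
  oapp (fun i : 'I_#|K| =>
          mscale (w (enum_val i)) (\d_(x (enum_val i))) : {measure set T -> \bar R})
       mzero (insub i).

Definition mixture := msum mixture_part #|K|.

HB.instance Definition _ := Measure.on mixture.

Lemma ge0_integral_mixture (f : T -> \bar R) : measurable_fun setT f ->
  (forall y, 0 <= f y) -> \int[mixture]_y f y = \sum_k (w k)%:num%:E * f (x k).
Proof.
move=> mf f0; rewrite ge0_integral_measure_sum//.
rewrite (reindex_onto (enum_val : 'I_#|K| -> K) enum_rank)/=; last first.
  by move=> k _; rewrite enum_rankK.
apply: eq_big => [i|i _]; first by rewrite enum_valK eqxx.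
rewrite /mixture_part valK/= ge0_integral_mscale// integral_dirac//.
by rewrite diracT mul1e.
Qed.

Let mixture_setT : mixture setT = 1.
Proof.
rewrite -[LHS]mul1e -integral_cst// ge0_integral_mixture//.
by under eq_bigr do rewrite /cst mule1; rewrite sumEFin weight_sum.
Qed.

HB.instance Definition _ := @Measure_isProbability.Build _ _ R mixture mixture_setT.

Lemma mixture1 (A : set T) : measurable A -> (forall k, A (x k)) -> mixture A = 1.
Proof.
move=> mA Ax; rewrite -(setIT A) -integral_indic// ge0_integral_mixture//.
- under eq_bigr do rewrite indicE mem_set// mule1.
  by rewrite sumEFin weight_sum.
- by apply/measurable_EFinP; exact: measurable_indic.
Qed.

(** Tonelli splits off the first draw, which becomes a sum over [K]; induction treats the others,
    and [cons_ffun] merges both sums into one. *)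
Lemma ge0_integral_iid_mixture n (f : n.-tuple T -> \bar R) :
  measurable_fun setT f -> (forall y, 0 <= f y) ->
  \int[iid mixture n]_y f y =
  \sum_(a : {ffun 'I_n -> K}) (\prod_(i < n) (w (a i))%:num)%:E * f [tuple x (a i) | i < n].
Proof.
elim: n f => [|n IH] f mf f0.
  (* With no draws the only index is the empty function. *)
  rewrite /= integral_dirac// diracT mul1e (big_pred1 [ffun i => False_rect K (notF (valP i))]).
    by rewrite big_ord0 mul1e; congr f; apply: eq_from_tnth => -[].
  by move=> a; symmetry; apply/eqP/ffunP => -[].
rewrite /= ge0_integral_distribution//.
have mcons : measurable_fun setT (f \o @tuple_cons _ T n).
  by apply: measurableT_comp => //; exact: measurable_tuple_cons.
rewrite fubini_tonelli1//; last by move=> y; exact: f0.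
transitivity (\sum_k (w k)%:num%:E *
    fubini_F (iid mixture n) (f \o @tuple_cons _ T n) (x k)).
  apply: ge0_integral_mixture; first by apply: measurable_fun_fubini_tonelli_F => // y; exact: f0.
  by move=> y; apply: integral_ge0 => z _; exact: f0.
pose cons_ffun (ka : K * {ffun 'I_n -> K}) : {ffun 'I_n.+1 -> K} :=
  [ffun i => oapp ka.2 ka.1 (unlift ord0 i)].
pose split_ffun (a : {ffun 'I_n.+1 -> K}) := (a ord0, [ffun i => a (lift ord0 i)]).
rewrite [RHS](reindex cons_ffun)/=; last first.
  exists split_ffun => [[k a] _|a _]; rewrite /split_ffun /cons_ffun/=.
    by congr pair; [rewrite ffunE unlift_none | apply/ffunP => i; rewrite !ffunE liftK].
  by apply/ffunP => i; rewrite ffunE; case: unliftP => [j|] -> //=; rewrite ffunE.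
rewrite -(pair_bigA _ (fun k a => (\prod_(i < n.+1) (w (cons_ffun (k, a) i))%:num)%:E *
  f [tuple x (cons_ffun (k, a) i) | i < n.+1]))/=.
apply: eq_bigr => k _; rewrite /fubini_F IH//=; last first.
  by exact: (measurableT_comp mcons (pair1_measurable (x k))).
rewrite ge0_sume_distrr => [|a _]; last first.
  by rewrite mule_ge0// lee_fin prodr_ge0.
apply: eq_bigr => a _; rewrite muleA -EFinM; congr (_%:E * f _).
  rewrite big_ord_recl /cons_ffun ffunE unlift_none; congr (_ * _)%R.
  by apply: eq_bigr => i _; rewrite ffunE liftK.
apply: eq_from_tnth => i; rewrite tnth_mktuple ffunE.
by case: unliftP => [j|] -> /=; rewrite ?tnthS ?tnth0 ?tnth_mktuple.
Qed.

End FiniteMixture.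

(* Negative values of f off the atoms are harmless. *)
Lemma integral_atomic d (T : measurableType d) (R : realType) (mu : {measure set T -> \bar R})
    (A : finType) (c : A -> R) (y : A -> T) :
  (forall f : T -> \bar R, measurable_fun setT f -> (forall z, 0 <= f z)%E ->
     (\int[mu]_z f z = \sum_a (c a)%:E * f (y a))%E) ->
  forall f : T -> R, measurable_fun setT f -> (forall a, 0 <= f (y a)) ->
  (\int[mu]_z (f z)%:E)%E = (\sum_a c a * f (y a))%:E.
Proof.
move=> intE f mf f0; have mEf : measurable_fun setT (EFin \o f) by exact/measurable_EFinP.
rewrite integralE !intE//; [|exact: measurable_funeneg|exact: measurable_funepos].
rewrite [X in (_ - X)%E]big1 ?sube0 => [|a _]; last first.
  by rewrite unlock/= max_r ?mule0// lee_fin oppr_le0.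
rewrite -sumEFin; apply: eq_bigr => a _.
by rewrite unlock/= max_l ?EFinM// lee_fin.
Qed.


(** * An exponential tail bound for independent draws *)

Section ProductLaw.
Context (R : realType) (T : finType).
Variable Q : T -> R.
Hypotheses (Q0 : forall x, 0 <= Q x) (Q1 : \sum_x Q x = 1).

(** From 1 - x <= e^(-x) follows e^x <= 1 / (1 - x), while (1 + x + 2 x^2)(1 - x) = 1 + x^2 (1 - 2
    x) >= 1. *)
Lemma expR_le_quadratic (x : R) : x <= 1 / 2 -> expR x <= 1 + x + 2 * x ^+ 2.
Proof.
move=> x2; have h : (0 : R) < 1 - x by lra.
have : expR x * (1 - x) <= 1.
  have := expR_ge1Dx (- x); rewrite expRN => le.
  by rewrite -[leRHS](divff (lt0r_neq0 (expR_gt0 x))) ler_pM2l ?expR_gt0.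
rewrite -ler_pdivlMr// => /le_trans; apply.
by rewrite ler_pdivrMr//; nra.
Qed.

(** Markov's inequality for the exponential of -mu / 4 times the sum, where [mu] is the mean of [g];
    the quadratic bound gives rho <= 1 - mu^2 / 4 + mu^2 / 8 < 1. *)
Lemma chernoff (g : T -> R) : (forall x, `|g x| <= 1) -> 0 < \sum_x Q x * g x ->
  exists2 rho, 0 <= rho < 1 &
    forall n, \sum_(p : {ffun 'I_n -> T} | \sum_(i < n) g (p i) <= 0) \prod_(i < n) Q (p i)
      <= rho ^+ n.
Proof.
move=> g1 mu0; set mu := \sum_x _ in mu0.
have mu1 : mu <= 1.
  rewrite -Q1; apply: ler_sum => x _; rewrite ler_piMr//.
  by rewrite (le_trans (ler_norm _))// g1.
pose rho := \sum_x Q x * expR (- (mu / 4 * g x)).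
have rho0 : 0 <= rho by apply: sumr_ge0 => x _; rewrite mulr_ge0// expR_ge0.
have rhole : rho <= 1 - mu / 4 * mu + mu ^+ 2 / 8.
  have -> : 1 - mu / 4 * mu + mu ^+ 2 / 8 =
      \sum_x Q x * (1 - mu / 4 * g x + mu ^+ 2 / 8).
    transitivity (\sum_x (Q x * (1 + mu ^+ 2 / 8) - mu / 4 * (Q x * g x))).
      by rewrite sumrB -mulr_suml -mulr_sumr -/mu Q1; ring.
    by apply: eq_bigr => x _; ring.
  apply: ler_sum => x _; have /ler_normlP[g_ge g_le] := g1 x.
  apply: ler_wpM2l => //; apply: (le_trans (expR_le_quadratic _)); first by nra.
  have gg : 0 <= 1 - g x ^+ 2 by nra.
  have := mulr_ge0 (sqr_ge0 mu) gg; lra.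
exists rho => [|n]; first by rewrite rho0 (le_lt_trans rhole)//; nra.
(* The power expands into a sum over all [p]; only those with a nonpositive sum of [g] are kept, and
   there the exponential factor is at least 1. *)
rewrite -[n in rho ^+ n]card_ord -prodr_const bigA_distr_bigA/=.
rewrite [leRHS](bigID (fun p : {ffun 'I_n -> T} => \sum_(i < n) g (p i) <= 0))/=.
rewrite ler_wpDr ?sumr_ge0// => [p _|].
  by rewrite prodr_ge0// => i _; rewrite mulr_ge0 ?expR_ge0.
apply: ler_sum => p gp; rewrite big_split/= ler_peMr ?prodr_ge0//.
rewrite -expR_sum -[leLHS]expR0 ler_expR sumrN oppr_ge0 -mulr_sumr pmulr_rle0//.
by nra.
Qed.

Lemma sum_prod_law_proj n (i : 'I_n) (h : T -> R) :
  \sum_(p : {ffun 'I_n -> T}) (\prod_(j < n) Q (p j)) * h (p i) = \sum_x Q x * h x.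
Proof.
pose F j x := Q x * (if j == i then h x else 1).
rewrite (eq_bigr (fun p : {ffun 'I_n -> T} => \prod_j F j (p j))) => [|p _].
  rewrite -bigA_distr_bigA (bigD1 i)//= [X in _ * X]big1 ?mulr1.
    by apply: eq_bigr => x _; rewrite /F eqxx.
  by move=> j /negbTE ji; rewrite -[RHS]Q1; apply: eq_bigr => x _; rewrite /F ji mulr1.
rewrite big_split/=; congr (_ * _); rewrite (bigD1 i)//= eqxx big1 ?mulr1//.
by move=> j /negbTE ->.
Qed.

End ProductLaw.

(** * Expected utilities under a finite mixture *)

Section UtilRule.
Context (R : realType) (m : nat) (K : finType).
Variables (beta : R) (w : weights R K) (x : K -> m.+1.-tuple R).

Lemma measurable_plackett_luce (s : ranking m.+1) :
  measurable_fun setT (fun u : m.+1.-tuple R => plackett_luce beta u s).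
Proof.
have mexp c : measurable_fun setT (fun u : m.+1.-tuple R => expR (beta * tnth u c)).
  apply: measurableT_comp => //; apply: measurable_funM => //; exact: measurable_tnth.
apply: measurable_prod => k _; apply: measurable_funM => //.
(* The sum is positive, so its inverse can be written with [expR] and [ln], both measurable. *)
rewrite (_ : (fun _ => _) = fun u : m.+1.-tuple R =>
  expR (- ln (\sum_(l < m.+1 | (k <= l)%N) expR (beta * tnth u (s l))))); last first.
  apply/funext => u; rewrite expRN lnK// posrE.
  by apply: (tail_sum_gt0 (w := fun c => expR (beta * tnth u c))) => c; exact: expR_gt0.
apply: measurableT_comp => //; apply: measurableT_comp => //.
apply: measurableT_comp; first exact: measurable_ln.
under eq_fun do rewrite big_mkcond/=.
by apply: measurable_sum => l; case: (k <= l)%N.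
Qed.

(** The law of one voter's ranking once the utilities are averaged out; a profile consists of
    independent draws from it. *)
Definition ranking_law (s : ranking m.+1) : R :=
  \sum_k (w k)%:num * plackett_luce beta (x k) s.

Lemma plackett_luce_gt0 (u : m.+1.-tuple R) s : 0 < plackett_luce beta u s.
Proof.
by apply: (pl_gt0 (w := fun c => expR (beta * tnth u c))) => c; exact: expR_gt0.
Qed.

Lemma ranking_law_ge0 s : 0 <= ranking_law s.
Proof. by apply: sumr_ge0 => k _; rewrite mulr_ge0// ltW// plackett_luce_gt0. Qed.

Lemma sum_plackett_luce (u : m.+1.-tuple R) : \sum_(s : ranking m.+1) plackett_luce beta u s = 1.
Proof.
by apply: (sum_pl (w := fun c => expR (beta * tnth u c))) => c; exact: expR_gt0.
Qed.

Lemma sum_ranking_law : \sum_s ranking_law s = 1.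
Proof.
rewrite exchange_big -(weight_sum w)/=; apply: eq_bigr => k _.
by rewrite -mulr_sumr sum_plackett_luce mulr1.
Qed.

Hypothesis x01 : forall k c, 0 <= tnth (x k) c <= 1.

Lemma mixture_on_unit_cube : on_unit_cube (mixture w x).
Proof.
apply: mixture1 => [|k c]; last exact: x01.
rewrite [X in measurable X](_ : _ =
  (\bigcap_(c in [set: 'I_m.+1])
    ((fun u : m.+1.-tuple R => tnth u c) @^-1` `[0%R, 1%R]))%classic); last first.
  by apply/seteqP; split => [u h c _|u h c] /=; rewrite ?in_itv/=;
    [exact: h | have := h c I; rewrite /= in_itv].
apply: fin_bigcap_measurable => // c _; rewrite -[X in measurable X]setTI.
exact: measurable_tnth.
Qed.

Lemma util_mixture c : util (mixture w x) c = (\sum_k (w k)%:num * tnth (x k) c)%:E.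
Proof.
rewrite /util unlock; apply: (integral_atomic (c := fun k => (w k)%:num)) => [f mf f0||k].
- exact: ge0_integral_mixture.
- exact: measurable_tnth.
- by case/andP: (x01 k c).
Qed.

Lemma sum_sure c (F : 'I_m.+1 -> R) : \sum_c' sure R c c' * F c' = F c.
Proof.
rewrite (bigD1 c)//= eqxx mul1r big1 ?addr0// => c' /negbTE /= ->.
by rewrite mul0r.
Qed.

Lemma util_rule_mixture (win : forall n, profile m.+1 n -> 'I_m.+1) n :
  util_rule beta (mixture w x) (deterministic_rule R win) n =
  (\sum_(a : {ffun 'I_n -> K}) (\prod_(i < n) (w (a i))%:num) *
    \sum_(p : profile m.+1 n) (\prod_(i < n) plackett_luce beta (x (a i)) (p i)) *
      (n%:R^-1 * \sum_(i < n) tnth (x (a i)) (win n p)))%:E.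
Proof.
rewrite /util_rule unlock.
under eq_integral => us _.
  under eq_bigr => p _ do rewrite sum_sure.
  over.
rewrite (integral_atomic (c := fun a : {ffun 'I_n -> K} => \prod_(i < n) (w (a i))%:num)
  (y := fun a => [tuple x (a i) | i < n])).
- congr (_%:E); apply: eq_bigr => a _; congr (_ * _); apply: eq_bigr => p _; congr (_ * (_ * _)).
    by apply: eq_bigr => i _; rewrite tnth_mktuple.
  by apply: eq_bigr => i _; rewrite tnth_mktuple.
- by move=> f mf f0; exact: ge0_integral_iid_mixture.
- apply: measurable_sum => p; apply: measurable_funM.
    apply: measurable_prod => i _.
    exact: (measurableT_comp (measurable_plackett_luce _) (measurable_tnth _)).
  apply: measurable_funM => //; apply: measurable_sum => i.
  exact: (measurableT_comp (measurable_tnth _) (measurable_tnth _)).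
- move=> a; apply: sumr_ge0 => p _; rewrite mulr_ge0//.
    by apply: prodr_ge0 => i _; rewrite ltW// plackett_luce_gt0.
  rewrite mulr_ge0// sumr_ge0// => i _; rewrite tnth_mktuple.
  by case/andP: (x01 (a i) (win n p)).
Qed.

(* The winner b contributes its expected utility, any other winner at most 1. *)
Lemma util_rule_mixture_bounds (win : forall n, profile m.+1 n -> 'I_m.+1) b n :
  exists2 r : R, util_rule beta (mixture w x) (deterministic_rule R win) n = r%:E &
   0 <= r <= \sum_k (w k)%:num * tnth (x k) b +
     \sum_(p : profile m.+1 n | win n p != b) \prod_(i < n) ranking_law (p i).
Proof.
rewrite util_rule_mixture; eexists; first by [].
have w0 (a : {ffun 'I_n -> K}) : 0 <= \prod_(i < n) (w (a i))%:num by exact: prodr_ge0.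
have pl0 (a : {ffun 'I_n -> K}) (p : profile m.+1 n) :
  0 <= \prod_(i < n) plackett_luce beta (x (a i)) (p i).
  by apply: prodr_ge0 => i _; rewrite ltW// plackett_luce_gt0.
have avg0 (a : {ffun 'I_n -> K}) c : 0 <= n%:R^-1 * \sum_(i < n) tnth (x (a i)) c.
  by rewrite mulr_ge0// sumr_ge0// => i _; case/andP: (x01 (a i) c).
have avg1 (a : {ffun 'I_n -> K}) c : n%:R^-1 * \sum_(i < n) tnth (x (a i)) c <= 1.
  (* For [n = 0] the convention [0^-1 = 0] makes the average 0. *)
  case: n a {w0 pl0 avg0} => [|n] a; first by rewrite big_ord0 mulr0.
  rewrite mulrC ler_pdivrMr// mul1r -[n.+1 in leRHS]card_ord -sumr_const.
  by apply: ler_sum => i _; case/andP: (x01 (a i) c).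
apply/andP; split.
  by apply: sumr_ge0 => a _; rewrite mulr_ge0// sumr_ge0// => p _; rewrite mulr_ge0.
apply: (@le_trans _ _ (\sum_(a : {ffun 'I_n -> K}) (\prod_(i < n) (w (a i))%:num) *
    \sum_(p : profile m.+1 n) (\prod_(i < n) plackett_luce beta (x (a i)) (p i)) *
      (n%:R^-1 * \sum_(i < n) tnth (x (a i)) b + (win n p != b)%:R))).
  apply: ler_sum => a _; rewrite ler_wpM2l//; apply: ler_sum => p _; rewrite ler_wpM2l//.
  by have [->|_] := eqVneq; rewrite ?addr0// (le_trans (avg1 _ _))// lerDr.
rewrite (eq_bigr (fun a : {ffun 'I_n -> K} =>
    (\prod_(i < n) (w (a i))%:num) * (n%:R^-1 * \sum_(i < n) tnth (x (a i)) b) +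
    \sum_(p : profile m.+1 n | win n p != b)
      \prod_(i < n) ((w (a i))%:num * plackett_luce beta (x (a i)) (p i)))); last first.
  move=> a _; rewrite [X in _ * X](eq_bigr (fun p : profile m.+1 n =>
    (\prod_(i < n) plackett_luce beta (x (a i)) (p i)) *
      (n%:R^-1 * \sum_(i < n) tnth (x (a i)) b) +
    (\prod_(i < n) plackett_luce beta (x (a i)) (p i)) * (win n p != b)%:R)); last first.
    by move=> p _; exact: mulrDr.
  rewrite big_split/= mulrDr -mulr_suml.
  congr (_ * _ + _).
    rewrite -[RHS]mul1r; congr (_ * _).
    rewrite -(bigA_distr_bigA (fun i => plackett_luce beta (x (a i))))/= big1// => i _.
    exact: sum_plackett_luce.
  rewrite mulr_sumr [RHS]big_mkcond/=; apply: eq_bigr => p _.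
  by rewrite big_split/=; case: ifP => _; rewrite ?mulr1 ?mulr0.
rewrite big_split/= lerD//.
  rewrite (eq_bigr (fun a : {ffun 'I_n -> K} => n%:R^-1 * \sum_(i < n)
    ((\prod_(j < n) (w (a j))%:num) * tnth (x (a i)) b))) => [|a _]; last first.
    by rewrite mulrCA mulr_sumr.
  rewrite -mulr_sumr exchange_big/=.
  under eq_bigr => i _ do rewrite (sum_prod_law_proj (weight_sum w) i (fun k => tnth (x k) b)).
  rewrite sumr_const card_ord -[X in _ * X]mulr_natl mulrA ler_piMl//.
    by apply: sumr_ge0 => k _; rewrite mulr_ge0//; case/andP: (x01 k b).
  by case: n {w0 pl0 avg0 avg1} => [|n]; rewrite ?mulr0// mulVf.
(* Summing over the voters' utilities first factorizes into one [ranking_law] per voter. *)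
rewrite exchange_big/= le_eqVlt; apply/orP; left; apply/eqP; apply: eq_bigr => p _.
by rewrite -(bigA_distr_bigA (fun i k => (w k)%:num * plackett_luce beta (x k) (p i))).
Qed.

End UtilRule.

(** * The three blocs of approval voters *)

Section Instance.
Context (R : realType) (m : nat) (b : 'I_m.+1) (s : nat) (beta p q : R).
Hypotheses (beta0 : 0 <= beta) (sm : (s <= m)%N).
Hypotheses (p0 : 0 <= p) (q0 : 0 <= q) (pq1 : p + q <= 1).

Definition rival_sets := [set A : {set 'I_m.+1} | (b \notin A) && (#|A| == s)].

Lemma card_rival_sets_gt0 : 0 < #|rival_sets|%:R :> R.
Proof.
rewrite ltr0n (_ : rival_sets = [set A : {set 'I_m.+1} | A \subset [set~ b] & #|A| == s]).
  by rewrite cards_draws bin_gt0 cardsC1 card_ord.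
by apply/finset.setP => A; rewrite !inE -finset.disjoints_subset disjoint_sym disjoints1.
Qed.

(** The indicators are added, not separated by cases: for [s = 0] the empty set collects two of the
    terms and the total remains 1. *)
Definition bloc_weight (A : {set 'I_m.+1}) : R :=
  (1 - p - q) * (A == finset.set0)%:R + p * (A == [set b])%:R +
  q / #|rival_sets|%:R * (A \in rival_sets)%:R.

Lemma bloc_weight_ge0 A : 0 <= bloc_weight A.
Proof.
have r0 : 0 <= 1 - p - q by rewrite -addrA -opprD subr_ge0.
have N0 := ltW card_rival_sets_gt0.
by rewrite /bloc_weight !addr_ge0// mulr_ge0// divr_ge0.
Qed.

Lemma sum_bloc_weight F : \sum_A bloc_weight A * F A =
  (1 - p - q) * F finset.set0 + p * F [set b] +
  q / #|rival_sets|%:R * \sum_(A in rival_sets) F A.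
Proof.
under eq_bigr => A _ do rewrite /bloc_weight mulrDl [X in X + _]mulrDl.
rewrite !big_split/=; congr (_ + _ + _).
- by rewrite (bigD1 finset.set0)//= eqxx mulr1 big1 ?addr0// => A /negbTE ->; rewrite mulr0 mul0r.
- by rewrite (bigD1 [set b])//= eqxx mulr1 big1 ?addr0// => A /negbTE ->; rewrite mulr0 mul0r.
- rewrite mulr_sumr [RHS]big_mkcond; apply: eq_bigr => A _.
  by case: ifP => _; rewrite ?mulr1// mulr0 mul0r.
Qed.

Lemma sum_rival_sets_cst (c : R) : q / #|rival_sets|%:R * \sum_(A in rival_sets) c = q * c.
Proof.
by rewrite sumr_const -[c *+ _]mulr_natl mulrA divfK// gt_eqF// card_rival_sets_gt0.
Qed.

Lemma bloc_weight_sum : \sum_A (NngNum (bloc_weight_ge0 A))%:num = 1.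
Proof.
transitivity (\sum_A bloc_weight A * 1); first by apply: eq_bigr => A _; rewrite mulr1.
by rewrite sum_bloc_weight sum_rival_sets_cst; ring.
Qed.

Definition bloc_weights := Weights bloc_weight_sum.

Definition approval (A : {set 'I_m.+1}) : m.+1.-tuple R :=
  [tuple (c \in A)%:R | c < m.+1].

Lemma approval01 A c : 0 <= tnth (approval A) c <= 1.
Proof. by rewrite tnth_mktuple; case: (c \in A); rewrite ?ler01 ?lexx. Qed.

Let law := ranking_law beta bloc_weights approval.

Definition first_prob (c : 'I_m.+1) : R := \sum_(r : ranking m.+1 | r ord0 == c) law r.
Definition last_prob (c : 'I_m.+1) : R := \sum_(r : ranking m.+1 | r ord_max == c) law r.

Lemma sum_first_prob : \sum_c first_prob c = 1.
Proof.
by rewrite -(sum_ranking_law beta bloc_weights approval) [RHS]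
  (partition_big (fun r : ranking m.+1 => r ord0) xpredT).
Qed.

Lemma sum_last_prob : \sum_c last_prob c = 1.
Proof.
by rewrite -(sum_ranking_law beta bloc_weights approval) [RHS]
  (partition_big (fun r : ranking m.+1 => r ord_max) xpredT).
Qed.

(** Swapping two rivals fixes [b] and permutes [rival_sets], so the weights are invariant when the
    approval sets are replaced by their preimages. *)
Lemma law_tperm j j' r : j != b -> j' != b -> law (r * tperm j j')%g = law r.
Proof.
move=> jb j'b; set t := tperm j j'.
have tb : t b = b by rewrite tpermD.
have tK : involutive (fun A : {set 'I_m.+1} => t @^-1: A).
  by move=> A; apply/finset.setP => c; rewrite !inE tpermK.
rewrite /law /ranking_law [RHS](reindex_inj (inv_inj tK))/=.
apply: eq_bigr => A _; congr (_ * _).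
  rewrite /bloc_weight !(can2_eq tK tK) preimset0.
  have -> : t @^-1: [set b] = [set b].
    by apply/finset.setP => c; rewrite !inE -(inj_eq (@perm_inj _ t)) tpermK tb.
  by rewrite !inE tb card_preimset//; exact: perm_inj.
rewrite -[LHS]/(pl (fun c => expR (beta * tnth (approval A) c)) (r * t)%g) pl_perm.
rewrite (_ : _ \o _ = fun c => expR (beta * tnth (approval (t @^-1: A)) c))//.
by apply/funext => c /=; rewrite !tnth_mktuple inE.
Qed.

Lemma first_prob_tperm j j' : j != b -> j' != b -> first_prob j = first_prob j'.
Proof.
move=> jb j'b; rewrite /first_prob [LHS](reindex_inj (mulIg (tperm j j')))/=.
by apply: eq_big => r; [rewrite permM (canF_eq (tpermK j j')) tpermL | rewrite law_tperm].
Qed.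

Lemma last_prob_tperm j j' : j != b -> j' != b -> last_prob j = last_prob j'.
Proof.
move=> jb j'b; rewrite /last_prob [LHS](reindex_inj (mulIg (tperm j j')))/=.
by apply: eq_big => r; [rewrite permM (canF_eq (tpermK j j')) tpermL | rewrite law_tperm].
Qed.

Lemma sum_law (P : pred (ranking m.+1)) : \sum_(r | P r) law r =
  \sum_A bloc_weight A * \sum_(r | P r) plackett_luce beta (approval A) r.
Proof.
by rewrite exchange_big/=; apply: eq_bigr => A _; rewrite mulr_sumr.
Qed.

Lemma approval_first A c : \sum_(r : ranking m.+1 | r ord0 == c) plackett_luce beta (approval A) r =
  expR (beta * (c \in A)%:R) / \sum_c' expR (beta * (c' \in A)%:R).
Proof.
rewrite (sum_pl_first (w := fun c => expR (beta * tnth (approval A) c))) => [|c'];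
  last exact: expR_gt0.
by rewrite tnth_mktuple; congr (_ / _); apply: eq_bigr => c' _; rewrite tnth_mktuple.
Qed.

Lemma approval_first_ge0 A c :
  0 <= \sum_(r : ranking m.+1 | r ord0 == c) plackett_luce beta (approval A) r.
Proof. by apply: sumr_ge0 => r _; rewrite ltW// plackett_luce_gt0. Qed.

(** The set collects the candidates no heavier than [c]: all of them if [c] is approved, the
    complement of [A] otherwise. *)
Lemma approval_last_le (A : {set 'I_m.+1}) c k :
  (0 < k <= #|[set j | (j \in A) ==> (c \in A)]|)%N ->
  \sum_(r : ranking m.+1 | r ord_max == c) plackett_luce beta (approval A) r <= k%:R^-1.
Proof.
case/andP=> k0 kle.
have := sum_pl_last (w := fun c => expR (beta * tnth (approval A) c)) c (fun=> expR_gt0 _).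
move=> le1; rewrite -[k%:R^-1]mul1r ler_pdivlMr ?ltr0n// mulrC; apply: le_trans le1.
apply: ler_wpM2r; first by apply: sumr_ge0 => r _; rewrite ltW// plackett_luce_gt0.
rewrite ler_nat (leq_trans kle)// subset_leq_card//; apply/fintype.subsetP => j.
rewrite !inE !tnth_mktuple ler_expR => h; apply: ler_wpM2l => //.
by rewrite ler_nat; case: (j \in A) h => //= ->.
Qed.

(** Only the first places given by the indifferent voters are counted. *)
Lemma first_prob_ge c : (1 - p - q) / m.+1%:R <= first_prob c.
Proof.
rewrite /first_prob sum_law sum_bloc_weight -[leRHS]addrA ler_wpDr//.
  rewrite addr_ge0// mulr_ge0 ?approval_first_ge0//.
    by rewrite divr_ge0// ltW// card_rival_sets_gt0.
  by apply: sumr_ge0 => A _; exact: approval_first_ge0.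
rewrite approval_first !inE mulr0 expR0 le_eqVlt; apply/orP; left; apply/eqP.
congr (_ * _); rewrite div1r; congr (_^-1).
by rewrite (eq_bigr (fun=> 1)) ?sumr_const ?card_ord// => c' _; rewrite inE mulr0 expR0.
Qed.

Lemma first_prob_winner_ge :
  (1 - p - q) / m.+1%:R + p * (expR beta / (expR beta + m%:R)) <= first_prob b.
Proof.
rewrite /first_prob sum_law sum_bloc_weight ler_wpDr//.
  rewrite mulr_ge0// ?divr_ge0// ?(ltW card_rival_sets_gt0)//.
  by apply: sumr_ge0 => A _; exact: approval_first_ge0.
rewrite !approval_first !inE mulr0 expR0 eqxx mulr1 div1r.
rewrite (eq_bigr (fun=> 1)) ?sumr_const ?card_ord//; last by move=> c' _; rewrite inE mulr0 expR0.
rewrite (bigD1 b)//= inE eqxx mulr1 (eq_bigr (fun=> 1)); last first.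
  by move=> c /negbTE cb; rewrite inE cb mulr0 expR0.
by rewrite sumr_const cardC1 card_ord.
Qed.

(** For indifferent voters and for its own supporters no candidate is heavier than [b]; for the
    others [b] ties with the [m.+1 - s] candidates outside their set. *)
Lemma last_prob_winner_le :
  last_prob b <= (1 - p - q) / m.+1%:R + p / m.+1%:R + q / (m.+1 - s)%:R.
Proof.
rewrite /last_prob sum_law sum_bloc_weight.
have full (A : {set 'I_m.+1}) : (forall j, (j \in A) ==> (b \in A)) ->
  \sum_(r : ranking m.+1 | r ord_max == b) plackett_luce beta (approval A) r <= m.+1%:R^-1.
  move=> h; apply: approval_last_le => /=; rewrite -[X in (X <= _)%N]card_ord -cardsT.
  by apply: subset_leq_card; apply/fintype.subsetP => j _; rewrite inE h.
apply: lerD; first apply: lerD.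
- by rewrite ler_wpM2l ?full// => [|j]; rewrite ?inE// -addrA -opprD subr_ge0.
- by rewrite ler_wpM2l ?full// => j; rewrite !inE eqxx implybT.
- rewrite -[leRHS]sum_rival_sets_cst ler_wpM2l//.
    by rewrite divr_ge0// ltW// card_rival_sets_gt0.
  apply: ler_sum => A; rewrite inE => /andP[bA /eqP As].
  apply: approval_last_le; rewrite subn_gt0 ltnS sm/=.
  have -> : (m.+1 - s)%N = #|~: A| by rewrite [RHS]cardsCs finset.setCK card_ord As.
  by apply/subset_leq_card/fintype.subsetP => j; rewrite !inE => /negbTE ->.
Qed.

End Instance.

(** * Numerical estimates and the choice of the shares *)

Lemma ln_ge_7_4 (R : realType) (x : R) : 10 <= x -> 7 / 4 <= ln x.
Proof.
move=> x10; rewrite -[leLHS]expRK ler_ln ?posrE ?expR_gt0//; last by lra.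
(* The bound e^(1/4) <= 4/3 comes from 1 - x <= e^(-x), and (4/3)^7 < 10. *)
apply: le_trans x10; have h : expR (1 / 4 : R) <= 4 / 3.
  have : (1 - 1 / 4) * expR (1 / 4 : R) <= 1.
    by rewrite -ler_pdivlMr ?expR_gt0// [leRHS]div1r -expRN expR_ge1Dx.
  lra.
rewrite (_ : 7 / 4 = 7%:R * (1 / 4)); last by ring.
rewrite expRM_natl; apply: (@le_trans _ _ ((4 / 3) ^+ 7)); last by rewrite !exprS expr0; lra.
by apply: lerXn2r; rewrite ?nnegrE ?expR_ge0.
Qed.

(* The share theta = p / q must exceed 1 / ((M - s) P) for b to win, where P is
   the gap between the first and the last place of b among its own supporters,
   and stay below 6 s / (m X) for the ratio of utilities to exceed X / 6. *)
Lemma bloc_parameters (R : realFieldType) (alpha X E : R) (m : nat) (s := m.+1./2) :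
  0 < alpha -> (10 <= m.+1)%N -> 7 / 4 <= X -> 3 * X <= m.+1%:R -> X ^+ 2 <= E ->
  exists pq : R * R, [/\ 0 <= pq.1, 0 <= pq.2,
    alpha / ((6 + alpha) * m.+1%:R) < (1 - pq.1 - pq.2) / m.+1%:R,
    pq.1 / m.+1%:R + pq.2 / (m.+1 - s)%:R < pq.1 * (E / (E + m%:R)) &
    X / 6 * pq.1 < pq.2 * s%:R / m%:R].
Proof.
move=> a0 M10 X74 XM EX.
have sM : (s <= m.+1)%N by rewrite /s; lia.
have s0 : (0 < s)%N by rewrite /s; lia.
have sM0 : (0 < m.+1 - s)%N by rewrite /s; lia.
(* Depending on parity the right side is (m + 1)^2 or (m + 1)^2 - 1; the latter equals the left
   side. *)
have sq : (m * (m + 2) <= 4 * (s * (m.+1 - s)))%N.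
  by rewrite /s; have := odd_double_half m.+1; case: odd; nia.
have m9 : (9 : R) <= m%:R by rewrite (ler_nat _ 9).
move: sq; rewrite -(ler_nat R) !natrM natrD => sq.
move: s0 sM0; rewrite -2!(ltr0n R).
set S := s%:R in sq *; set T := (m.+1 - s)%:R in sq *; move=> s0 t0.
(* From here on [M] is the number of rivals, so that there are [M + 1] candidates. *)
move: XM; rewrite -[m.+1%:R]natr1; move: m9 sq; set M := m%:R => m9 sq XM.
have E1 : 8 / 7 * X <= E - 1 by nra.
pose P := E / (E + M) - 1 / (M + 1).
have PE : P = M * (E - 1) / ((M + 1) * (E + M)) by rewrite /P; field; lra.
have P0 : 0 < P by rewrite PE divr_gt0 ?mulr_gt0//; lra.
have key : X * M < 6 * (S * T) * P.
  (* As E + M = (E - 1) + (M + 1), a third of [h1] plus [h2] bounds X (M + 1) (E + M) by 29/24 (M +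
     1)^2 (E - 1), which is below 3/2 M (M + 2) (E - 1) for M >= 9. Then [sq] gives [key]. *)
  have : X < 3 / 2 * (M + 2) * P.
    rewrite PE mulrA ltr_pdivlMr; last by rewrite mulr_gt0//; lra.
    have h1 : 3 * X * (M + 1) * (E - 1) <= (M + 1) * (M + 1) * (E - 1).
      by apply: ler_wpM2r; [lra|rewrite ler_pM2r; lra].
    have h2 : X * (M + 1) ^+ 2 <= 7 / 8 * (E - 1) * (M + 1) ^+ 2.
      by apply: ler_wpM2r; [exact: sqr_ge0|lra].
    nra.
  nra.
have ac : 1 / (T * P) < 6 * S / (M * X).
  rewrite ltr_pdivrMr ?mulr_gt0// mulrAC ltr_pdivlMr ?mulr_gt0//; lra.
pose theta := (1 / (T * P) + 6 * S / (M * X)) / 2.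
have [ta tc] : 1 / (T * P) < theta /\ theta < 6 * S / (M * X).
  by rewrite /theta; split; lra.
have th0 : 0 < theta by apply: lt_trans ta; rewrite divr_gt0// mulr_gt0.
(* This scaling makes both shares add up to 3 / (6 + alpha); the indifferent share (3 + alpha) / (6
   + alpha) then exceeds alpha / (6 + alpha), as the pruning threshold demands. *)
pose q := 3 / ((6 + alpha) * (1 + theta)).
have q0 : 0 < q by rewrite divr_gt0// mulr_gt0//; lra.
have pqE : q * theta + q = 3 / (6 + alpha) by rewrite /q; field; lra.
exists (q * theta, q) => /=; split.
- by rewrite mulr_ge0// ltW.
- exact: ltW.
- have -> : 1 - q * theta - q = (3 + alpha) / (6 + alpha).
    by rewrite -addrA -opprD pqE; field; lra.
  rewrite invfM mulrA !ltr_pM2r ?invr_gt0; lra.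
- move: ta; rewrite ltr_pdivrMr ?mulr_gt0// => ta.
  have : q / T < q * theta * P by rewrite ltr_pdivrMr// -mulrA -mulrA; nra.
  by rewrite /P; lra.
- move: tc; rewrite !ltr_pdivlMr ?mulr_gt0//; nra.
Qed.

(** * Union bound and passage to the limit *)

Lemma union_chernoff (R : realType) (T J : finType) (Q : T -> R) (g : J -> T -> R) :
  (forall x, 0 <= Q x) -> \sum_x Q x = 1 ->
  (forall j x, `|g j x| <= 1) -> (forall j, 0 < \sum_x Q x * g j x) ->
  forall eps, 0 < eps -> \forall n \near \oo%classic,
    \sum_(p : {ffun 'I_n -> T} | [exists j, \sum_(i < n) g j (p i) <= 0])
      \prod_(i < n) Q (p i) <= eps.
Proof.
move=> Q0 Q1 g1 g0 eps eps0.
(* Each of the finitely many events eventually has probability at most [d]; the successor keeps the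
   divisor positive for empty [J]. *)
pose d := eps / (#|J|.+1)%:R; have d0 : 0 < d by rewrite divr_gt0.
have : \forall n \near \oo%classic, forall j,
    \sum_(p : {ffun 'I_n -> T} | \sum_(i < n) g j (p i) <= 0) \prod_(i < n) Q (p i) <= d.
  apply: filter_forall => j.
  have [rho /andP[rho0 rho1] rhoP] := chernoff Q0 Q1 (g1 j) (g0 j).
  have rho_cvg : (rho ^+ n @[n --> \oo] --> (0 : R))%classic.
    by apply: cvg_expr; rewrite ger0_norm.
  have : \forall n \near \oo%classic, rho ^+ n <= d.
    by near do apply: ltW; apply: (cvgr_lt 0).
  by apply: filterS => n; apply: le_trans; exact: rhoP.
apply: filterS => n le_d.
apply: (@le_trans _ _ (\sum_j \sum_(p : {ffun 'I_n -> T} | \sum_(i < n) g j (p i) <= 0)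
    \prod_(i < n) Q (p i))); last first.
  apply: (@le_trans _ _ (\sum_(j : J) d)); first exact: ler_sum.
  rewrite sumr_const -[leLHS]mulr_natl mulrA ler_pdivrMr// mulrC ler_pM2l//.
  by rewrite ler_nat.
under [leRHS]eq_bigr do rewrite big_mkcond/=.
rewrite exchange_big/= big_mkcond/=; apply: ler_sum => p _.
have Qp : 0 <= \prod_(i < n) Q (p i) by exact: prodr_ge0.
case: ifPn => [/existsP[j gj]|_].
  by rewrite (bigD1 j)//= gj lerDl sumr_ge0// => k _; case: ifP.
by apply: sumr_ge0 => j _; case: ifP.
Unshelve. all: by end_near.
Qed.

(** The upper limit is an infimum of suprema over neighbourhoods of infinity, and each of these
    contains an index where the bound holds. *)
Lemma limn_esup_ge (R : realType) (u : nat -> \bar R) (c : \bar R) :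
  (\forall n \near \oo%classic, (c <= u n)%E) -> (c <= limn_esup u)%E.
Proof.
move=> cu; apply: le_ereal_inf_tmp => _ [V Voo <-].
have [n [Vn cn]] := filter_ex (filterI Voo cu).
by apply: (le_trans cn); apply: ereal_sup_ubound; exists n.
Qed.

(** The product form of the hypothesis admits [r = 0], where the ratio is infinite. *)
Lemma distortion_ratio_ge (R : realType) (t r : R) (x : \bar R) :
  0 <= r -> (0 < x)%E -> ((t * r)%:E <= x)%E -> (t%:E <= distortion_ratio x r%:E)%E.
Proof.
move=> r0 x0 tr; rewrite /distortion_ratio gt_eqF//=.
have [->|rn0] := eqVneq r 0; first by rewrite inve0 gt0_muley// leey.
by rewrite inver (negbTE rn0) lee_pdivlMr ?lt0r ?rn0// -EFinM.
Qed.

Lemma sum_indicator (R : pzRingType) n (P : pred 'I_n) :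
  \sum_(i < n) (P i)%:R = #|[set i | P i]|%:R :> R.
Proof.
rewrite -sum1_card natr_sum [RHS]big_mkcond/=.
by apply: eq_bigr => i _; rewrite inE; case: (P i).
Qed.

(* As b is also the default, the case where no winner is picked is harmless. *)
Lemma pruned_plurality_veto_margins (R : realType) (alpha : R) (m n : nat)
    (sigma : {perm 'I_n}) (p : profile m.+1 n) (b : 'I_m.+1) :
  (forall j, 0 <= \sum_(i < n) ((p i ord0 == j)%:R - alpha / ((6 + alpha) * m.+1%:R))) ->
  (forall j, j != b ->
     0 < \sum_(i < n) ((p i ord_max == j)%:R - (p i ord0 == j)%:R) :> R) ->
  odflt b (pruned_plurality_veto alpha sigma
    (fun i => [seq p i k | k <- enum 'I_m.+1])) = b.
Proof.
move=> unpr margin; case E : pruned_plurality_veto => [c|//] /=.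
have {E} : (#|[set i | p i ord_max == c]| <= #|[set i | p i ord0 == c]|)%N.
  apply: pruned_plurality_veto_winner E => j; have := unpr j.
  rewrite sumrB sum_indicator sumr_const card_ord subr_ge0 -[leLHS]mulr_natl.
  by rewrite mulrA [n%:R * alpha]mulrC.
apply: contraTeq => /margin; rewrite -ltnNge.
by rewrite sumrB !sum_indicator subr_gt0 ltr_nat.
Qed.

(** * Victory of [b] and the resulting distortion *)

Section Blocs.
Context (R : realType) (m : nat) (b : 'I_m.+1) (s : nat) (alpha beta p q : R).
Hypotheses (beta0 : 0 <= beta) (sm : (s <= m)%N) (m0 : (0 < m)%N).
Hypotheses (p0 : 0 <= p) (q0 : 0 <= q) (pq1 : p + q <= 1) (alpha0 : 0 < alpha).
Hypothesis unpruned_pq : alpha / ((6 + alpha) * m.+1%:R) < (1 - p - q) / m.+1%:R.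
Hypothesis winner_pq :
  p / m.+1%:R + q / (m.+1 - s)%:R < p * (expR beta / (expR beta + m%:R)).

Let W := bloc_weights b sm p0 q0 pq1.
Let law := ranking_law beta W (approval R (m := m)).

(** Both families sum to 1 and are constant on the rivals, so the surplus of first over last places
    of [b] is a deficit shared equally by the [m] rivals. *)
Lemma first_lt_last_prob j : j != b ->
  first_prob b beta sm p0 q0 pq1 j < last_prob b beta sm p0 q0 pq1 j.
Proof.
move=> jb.
have split_b (F : 'I_m.+1 -> R) : (forall c, c != b -> F c = F j) ->
    \sum_c F c = F b + m%:R * F j.
  move=> Fj; rewrite (bigD1 b)//= (eq_bigr (fun=> F j))// sumr_const cardC1 card_ord.
  by rewrite mulr_natl.
have := sum_first_prob b beta sm p0 q0 pq1.
rewrite split_b => [sumF|c cb]; last exact: first_prob_tperm.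
have := sum_last_prob b beta sm p0 q0 pq1.
rewrite split_b => [sumL|c cb]; last exact: last_prob_tperm.
have F_ge := first_prob_winner_ge b beta sm p0 q0 pq1.
have L_le := last_prob_winner_le b beta0 sm p0 q0 pq1.
have mgt0 : (0 : R) < m%:R by rewrite ltr0n.
rewrite -(ltr_pM2l mgt0) -(ltrD2l (first_prob b beta sm p0 q0 pq1 b)) sumF -[ltLHS]sumL ltrD2r.
by apply: le_lt_trans L_le (lt_le_trans _ F_ge); rewrite -addrA ltrD2l.
Qed.

(* The index (false, b) stands for no condition, hence the value 1. *)
Definition margin (e : bool * 'I_m.+1) (r : ranking m.+1) : R :=
  if e.1 then (r ord0 == e.2)%:R - alpha / ((6 + alpha) * m.+1%:R)
  else if e.2 == b then 1 else (r ord_max == e.2)%:R - (r ord0 == e.2)%:R.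

Lemma norm_margin_le1 e r : `|margin e r| <= 1.
Proof.
have a6 : 0 < 6 + alpha by rewrite addr_gt0.
have : 0 <= alpha / ((6 + alpha) * m.+1%:R) <= 1.
  apply/andP; split; first by rewrite divr_ge0 ?mulr_ge0 ?ltW.
  rewrite ler_pdivrMr ?mulr_gt0// mul1r.
  by rewrite (@le_trans _ _ (6 + alpha)) ?lerDr// ler_peMr ?ler1n// ltW.
rewrite /margin ler_norml; move: (alpha / _) => t /andP[t0 t1].
by case: ifP => _; last case: ifP => _; do ?[case: (_ == _)] => /=; lra.
Qed.

Lemma mean_margin_gt0 e : 0 < \sum_r law r * margin e r.
Proof.
have indE (P : pred (ranking m.+1)) : \sum_r law r * (P r)%:R = \sum_(r | P r) law r.
  rewrite [RHS]big_mkcond; apply: eq_bigr => r _.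
  by case: (P r); rewrite ?mulr1 ?mulr0.
have law1 : \sum_r law r = 1 by exact: sum_ranking_law.
case: e => -[] j; rewrite /margin/=.
  under eq_bigr do rewrite mulrBr; rewrite sumrB -mulr_suml law1 mul1r indE subr_gt0.
  exact: lt_le_trans unpruned_pq (first_prob_ge _ _ _ _ _ _ _).
have [_|jb] := eqVneq j b; first by rewrite -mulr_suml law1 mul1r.
under eq_bigr do rewrite mulrBr; rewrite sumrB !indE subr_gt0.
exact: first_lt_last_prob.
Qed.

(** When all margins have positive sums, nobody is pruned and no rival can win; hence a loss of [b]
    lies in the union of the events bounded by [union_chernoff]. *)
Lemma bloc_winner (sigma : forall n, {perm 'I_n}) eps : 0 < eps ->
  \forall n \near \oo%classic,
   \sum_(pr : profile m.+1 n |
         odflt b (pruned_plurality_veto alpha (sigma n)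
           (fun i => [seq pr i k | k <- enum 'I_m.+1])) != b)
     \prod_(i < n) law (pr i) <= eps.
Proof.
move=> eps0.
have law0 r : 0 <= law r by exact: ranking_law_ge0.
have law1 : \sum_r law r = 1 by exact: sum_ranking_law.
have := union_chernoff law0 law1 norm_margin_le1 mean_margin_gt0 eps0.
apply: filterS => n; apply: le_trans.
rewrite big_mkcond [leRHS]big_mkcond; apply: ler_sum => pr _.
case: ifPn => [bad|_]; last by case: ifP => _ //; exact: prodr_ge0.
rewrite ifT//; apply: contraR bad => /existsPn good; apply/eqP.
apply: pruned_plurality_veto_margins => [j|j jb].
  by have := good (true, j); rewrite -ltNge => /ltW.
by have := good (false, j); rewrite -ltNge /margin/= (negbTE jb).
Qed.

Lemma bloc_util_winner : \sum_A (W A)%:num * tnth (approval R A) b = p.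
Proof.
transitivity (\sum_A bloc_weight b s p q A * (b \in A)%:R).
  by apply: eq_bigr => A _; rewrite tnth_mktuple.
rewrite sum_bloc_weight !inE eqxx mulr0 mulr1 add0r [X in _ * X]big1 ?mulr0 ?addr0//.
by move=> A; rewrite inE => /andP[/negbTE ->].
Qed.

(** Every set in [rival_sets] has [s] members, so the contributions [U] of the rivals add up to
    [q * s] and one of them reaches the average. *)
Lemma bloc_util_rival : exists c,
  q * s%:R / m%:R <= \sum_A (W A)%:num * tnth (approval R A) c.
Proof.
have mgt0 : (0 : R) < m%:R by rewrite ltr0n.
pose U c := q / #|rival_sets b s|%:R * \sum_(A in rival_sets b s) (c \in A)%:R : R.
have UE c : U c <= \sum_A (W A)%:num * tnth (approval R A) c.
  rewrite (eq_bigr (fun A => bloc_weight b s p q A * (c \in A)%:R)) => [|A _]; last first.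
    by rewrite tnth_mktuple.
  by rewrite sum_bloc_weight lerDr !inE mulr0 add0r mulr_ge0.
suff [c Uc] : exists c, q * s%:R / m%:R <= U c by exists c; exact: le_trans (UE c).
apply/not_existsP => lt_U.
have : \sum_(c | c != b) U c = q * s%:R.
  rewrite -mulr_sumr exchange_big/= -[RHS](sum_rival_sets_cst b q sm); congr (_ * _).
  apply: eq_bigr => A; rewrite inE => /andP[bA /eqP <-].
  rewrite -sum1_card natr_sum [RHS]big_mkcond/= [RHS](bigD1 b)//= (negbTE bA) add0r.
  by apply: eq_bigr => c _; case: (c \in A).
apply/eqP; rewrite lt_eqF//.
have <- : \sum_(c | c != b) (q * s%:R / m%:R) = q * s%:R.
  by rewrite sumr_const cardC1 card_ord -[LHS]mulr_natr divfK// gt_eqF.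
(* Strictness of the summed inequality needs at least one rival. *)
have [c cb] : exists c, c != b.
  have [b_0|b_n0] := eqVneq b ord0; last by exists ord0; rewrite eq_sym.
  by exists ord_max; rewrite b_0 -val_eqE/= -lt0n.
apply: ltr_sum => [|c' c'b]; last by rewrite ltNge; apply/negP; exact: lt_U.
by apply/hasP; exists c => //; rewrite mem_index_enum.
Qed.

Lemma distortion_blocs_ge (sigma : forall n, {perm 'I_n}) (t : R) : 0 < t ->
  t * p < q * s%:R / m%:R ->
  (t%:E <= distortion beta (PrunedPluralityVeto alpha sigma b))%E.
Proof.
move=> t0 tp; set x := q * _ / _ in tp.
have [c xc] := bloc_util_rival.
(* The slack is chosen so that t (p + eps) = x: other winners, whose average utility is at most 1,
   may occur with probability [eps]. *)
pose eps := (x - t * p) / t; have eps0 : 0 < eps by rewrite divr_gt0// subr_gt0.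
have cube : on_unit_cube (mixture W (approval R (m := m))).
  by apply: mixture_on_unit_cube => A c'; exact: approval01.
apply: le_trans; last by apply: ereal_sup_ubound; exists (mixture W (approval R (m := m))).
apply: limn_esup_ge; apply: filterS (bloc_winner sigma eps0) => n le_eps.
have [r -> /andP[r0 rle]] := util_rule_mixture_bounds beta W (@approval01 _ _)
  (fun n pr => odflt b (pruned_plurality_veto alpha (sigma n)
           (fun i => [seq pr i k | k <- enum 'I_m.+1]))) b n.
have x_le : (x%:E <= \big[maxe/0%E]_(j < m.+1) util (mixture W (approval R (m := m))) j)%E.
  apply: le_trans (le_bigmax _ _ c).
  by rewrite util_mixture ?lee_fin// => A c'; exact: approval01.
have x0 : 0 < x by apply: le_lt_trans tp; rewrite mulr_ge0// ltW.
apply: distortion_ratio_ge => //; first exact: lt_le_trans x_le.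
apply: le_trans x_le; rewrite lee_fin.
have -> : x = t * (p + eps) by rewrite /eps; field; rewrite gt_eqF.
rewrite ler_pM2l// (le_trans rle)// bloc_util_winner lerD2l; exact: le_eps.
Qed.

End Blocs.

(** * From the conditions on [m] and [beta] to the shares of the blocs *)

Theorem corollary5p2 (R : realType) (alpha beta : R) (m : nat)
    (sigma : forall n, {perm 'I_n}) (c0 : 'I_m) :
  0 < alpha ->
  (10 <= m)%N ->
  1 <= beta ->
  beta <= m%:R / (3 * ln m%:R) ->
  2 * ln beta + 2 * ln (ln m%:R) <= beta ->
  ((beta * ln m%:R / 6)%:E
     <= distortion beta (PrunedPluralityVeto alpha sigma c0))%E.
Proof.
have half_le k : (9 < k.+1 -> (k.+1./2 <= k) && (0 < k))%N by lia.
case: m c0 => // m c0 alpha0 m10 beta1 beta_le beta_ge.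
have ln74 : 7 / 4 <= ln m.+1%:R :> R by apply: ln_ge_7_4; rewrite (ler_nat _ 10).
have ln0 : 0 < ln m.+1%:R :> R by lra.
have beta0 : 0 < beta by lra.
(* The claimed bound is [X / 6]; the two conditions on [beta] say that 3 X is at most the number of
   candidates and, after exponentiation, that X^2 <= e^beta. *)
pose X := beta * ln m.+1%:R.
have X74 : 7 / 4 <= X by rewrite /X; nra.
have XM : 3 * X <= m.+1%:R.
  by move: beta_le; rewrite ler_pdivlMr ?mulr_gt0// /X; lra.
have XE : X ^+ 2 <= expR beta.
  rewrite -[X](@lnK R) ?posrE ?mulr_gt0// -expRM_natl ler_expR.
  by rewrite lnM ?posrE//; lra.
have [[p q] [/= p0 q0 unpr win ratio]] := bloc_parameters alpha0 m10 X74 XM XE.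
have pq1 : p + q <= 1.
  have : 0 < (1 - p - q) / m.+1%:R.
    by apply: le_lt_trans unpr; rewrite divr_ge0 ?mulr_ge0//; lra.
  by rewrite pmulr_lgt0 ?invr_gt0//; lra.
have /andP[half_m m0] := half_le m m10.
apply: (distortion_blocs_ge c0 (ltW beta0) half_m m0 p0 q0 pq1 alpha0 unpr win).
  by rewrite /X in X74; lra.
rewrite -/X; lra.
Qed.
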